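(* Let $n\in\mathbb{N}$ be odd, with $n\geq 3$. Then no magic $n$-gon exists.
   Context: Let $n\ge 3$ and consider a regular $n$-gon with $2n+1$ nodes: the vertices $v_1,\dots,v_n$ (in clockwise order), the midpoints $m_1,\dots,m_n$ of the sides ($m_i$ is the midpoint of the side joining $v_i$ and $v_{i+1}$, with $v_{n+1}:=v_1$), and the center $c$. The sides are the $n$ triples of nodes $\{v_i,m_i,v_{i+1}\}$, $1\le i\le n$. The diagonals are the $n$ triples of nodes lying on a line through the center: if $n$ is even these are $\{v_i,c,v_{i+n/2}\}$ and $\{m_i,c,m_{i+n/2}\}$ for $1\le i\le n/2$; if $n$ is odd these are $\{v_i,c,m_{i+(n-1)/2}\}$ for $1\le i\le n$ (indices modulo $n$), i.e. each diagonal joins a vertex, the center, and the midpoint of the opposite side. A magic $n$-gon is an arrangement (bijective assignment) of the numbers $1,2,\dots,2n+1$ to the $2n+1$ nodes such that the sum of the three numbers on each side and the sum of the three numbers on each diagonal are all equal to one common value, called the magic sum. *)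

(* Defs.v *)
From mathcomp Require Import all_boot.

Set Implicit Arguments.
Unset Strict Implicit.
Unset Printing Implicit Defensive.

(* The 2n+1 nodes.  Indices run over 'I_n, i.e. they are 0-based: the
   vertex v_(i+1) of the usual clockwise labelling is [vertex i]. *)
Definition node (n : nat) : Type := option ('I_n + 'I_n).

Definition center {n : nat} : node n := None.
Definition vertex {n : nat} (i : 'I_n) : node n := Some (inl i).
Definition midpoint {n : nat} (i : 'I_n) : node n := Some (inr i).

(* The index i + k modulo n. *)
Definition shift {n : nat} (k : nat) (i : 'I_n) : 'I_n := iter k (@ordS n) i.

Definition sides (n : nat) : {set {set node n}} :=
  [set [set vertex i; midpoint i; vertex (shift 1 i)] | i : 'I_n].

Definition diagonals (n : nat) : {set {set node n}} :=
  if odd n then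
    [set [set vertex i; center; midpoint (shift n.-1./2 i)] | i : 'I_n]
  else
    [set [set vertex i; center; vertex (shift n./2 i)] | i : 'I_n & i < n./2]
    :|:
    [set [set midpoint i; center; midpoint (shift n./2 i)]
       | i : 'I_n & i < n./2].

(* A bijection from the nodes onto {1, ..., 2n+1}. *)
Definition arrangement (n : nat) (a : node n -> nat) : Prop :=
  injective a /\
  (forall k : nat, 1 <= k <= 2 * n + 1 <-> exists x : node n, a x = k).

Definition magic_ngon (n : nat) (a : node n -> nat) : Prop :=
  arrangement a /\
  exists s : nat, forall L : {set node n},
    L \in sides n :|: diagonals n -> \sum_(x in L) a x = s.

(* Main.v *)
Require Import Defs.
From mathcomp Require Import all_boot zify.

Set Implicit Arguments.
Unset Strict Implicit.
Unset Printing Implicit Defensive.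

(** Let [n] be odd and put [h := n.-1./2.+1], the inverse of 2 modulo [n]; write
    [x i] for the number at vertex [i] and [c] for the number at the center.

    The midpoint opposite to vertex [i + h] is midpoint [i].  So the side through
    midpoint [i] and the diagonal through it share that midpoint, and equating
    their sums eliminates its number: [x i + x (i + 1) = c + x (i + h)]
    (lemma [vertex_recurrence]).  As [1 = 2h] modulo [n], this says that [x]
    satisfies, along the steps of the rotation by [h], the linear recurrence
    [y_j + y_(j+2) = c + y_(j+1)].

    The characteristic polynomial [t^2 - t + 1] of this recurrence divides
    [t^3 + 1]: a solution is reflected in [c] after three steps, and returns to
    its value after six (lemmas [recurrence_reflect] and [recurrence_period]).
    Six steps of size [h] amount to the rotation by 3, and distinct vertices
    carry distinct numbers, so the rotation by 3 is trivial.  Three steps of size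
    [h] are [h] rotations by 3, hence also trivial; therefore [x i] is its own
    reflection in [c], that is [x i = c], which contradicts injectivity. *)

Section Recurrence.

Variables (T : Type) (f : T -> T) (x : T -> nat) (c : nat).
Hypothesis rec : forall t, x t + x (f (f t)) = c + x (f t).

(** Add the recurrence at [t] to the one at [f t]; the middle terms cancel. *)
Lemma recurrence_reflect t : x t + x (iter 3 f t) = c + c.
Proof. by move: (rec t) (rec (f t)) => /=; lia. Qed.

Lemma recurrence_period t : x (iter 6 f t) = x t.
Proof.
by move: (recurrence_reflect t) (recurrence_reflect (iter 3 f t)) => /=; lia.
Qed.

End Recurrence.

Lemma val_shift n k (i : 'I_n) : shift k i = (i + k) %% n :> nat.
Proof.
elim: k => [|k IHk]; first by rewrite addn0 modn_small.
by rewrite /= IHk -addn1 modnDml addn1 addnS.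
Qed.

Lemma shiftD n k l (i : 'I_n) : shift (k + l) i = shift k (shift l i).
Proof. exact: iterD. Qed.

Lemma shift_full n (i : 'I_n) : shift n i = i.
Proof. by apply: ord_inj; rewrite val_shift modnDr modn_small. Qed.

Lemma shift1_neq n (i : 'I_n) : 1 < n -> shift 1 i != i.
Proof.
move=> n_gt1; apply/eqP => /(congr1 (@nat_of_ord n)); rewrite val_shift => e.
have : i + 1 == i + 0 %[mod n] by rewrite e addn0 modn_small.
by rewrite eqn_modDl mod0n modn_small.
Qed.

Lemma iter_shift n k l (i : 'I_n) : iter l (shift k) i = shift (l * k) i.
Proof. by rewrite /shift -iterM. Qed.

Lemma double_half_succ {n} : odd n -> n.-1./2.+1 + n.-1./2.+1 = n.+1.
Proof. lia. Qed.

Lemma sum_set3 (T : finType) (g : T -> nat) (x y z : T) :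
  x != y -> x != z -> y != z ->
  \sum_(t in [set x; y; z]) g t = g x + g y + g z.
Proof.
move=> xy xz yz; rewrite setUC big_setU1 /= ?big_setU1 ?big_set1 /=.
- by rewrite addnC.
- by rewrite !inE.
- by rewrite !inE negb_or !(eq_sym z) xz yz.
Qed.

Section OddPolygon.

Variables (n : nat) (a : node n -> nat) (s : nat).
Hypotheses (n_gt1 : 1 < n) (n_odd : odd n).
Hypothesis line_sum :
  forall L : {set node n}, L \in sides n :|: diagonals n ->
  \sum_(t in L) a t = s.

Let h := n.-1./2.+1.

Lemma side_sum i :
  a (vertex i) + a (midpoint i) + a (vertex (shift 1 i)) = s.
Proof.
rewrite -(@line_sum [set vertex i; midpoint i; vertex (shift 1 i)]).
  rewrite sum_set3 //; apply/eqP => -[] /esym/eqP.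
  by apply/negP; exact: shift1_neq.
by rewrite inE; apply/orP; left; apply/imsetP; exists i.
Qed.

Lemma diagonal_sum i :
  a (vertex i) + a center + a (midpoint (shift n.-1./2 i)) = s.
Proof.
rewrite -(@line_sum [set vertex i; center; midpoint (shift n.-1./2 i)]).
  by rewrite sum_set3.
by rewrite inE /diagonals n_odd; apply/orP; right; apply/imsetP; exists i.
Qed.

Lemma shift_half_twice (i : 'I_n) : shift h (shift h i) = shift 1 i.
Proof.
by rewrite -shiftD (double_half_succ n_odd) -addn1 addnC shiftD shift_full.
Qed.

(** The side through midpoint [i] and the diagonal through it (which starts at
    vertex [i + h]) have equal sums, and midpoint [i] cancels. *)
Lemma vertex_recurrence i :
  a (vertex i) + a (vertex (shift h (shift h i)))
  = a center + a (vertex (shift h i)).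
Proof.
have opposite : shift n.-1./2 (shift h i) = i.
  rewrite -shiftD; have -> : n.-1./2 + h = n by rewrite /h; lia.
  exact: shift_full.
move: (side_sum i) (diagonal_sum (shift h i)).
by rewrite opposite shift_half_twice; lia.
Qed.

(** Six rotations by [h] make the rotation by 3, so injectivity turns the period
    of the recurrence into a statement about indices. *)
Lemma shift3_id (i : 'I_n) : injective a -> shift 3 i = i.
Proof.
move=> a_inj.
have :=
  @recurrence_period _ (shift h) (fun j => a (vertex j)) _ vertex_recurrence i.
have six_h : 6 * h = 3 + (n + (n + n)) by rewrite /h; lia.
by rewrite iter_shift six_h !shiftD !shift_full => /a_inj [].
Qed.

Lemma vertex_eq_center i : injective a -> a (vertex i) = a center.
Proof.
move=> a_inj.
have :=
  @recurrence_reflect _ (shift h) (fun j => a (vertex j)) _ vertex_recurrence i.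
have -> : iter 3 (@shift n h) i = i.
  (* The rotation by [3 * h] is read as [h] rotations by 3. *)
  by rewrite iter_shift mulnC -iter_shift iter_fix // shift3_id.
by lia.
Qed.

End OddPolygon.

Theorem theorem3p1 (n : nat) (hn : 3 <= n) (hodd : odd n) :
  ~ exists a : node n -> nat, magic_ngon a.
Proof.
move=> [a [[a_inj _] [s line_sum]]].
have i : 'I_n by exists 0; exact: leq_trans hn.
by have /a_inj := vertex_eq_center (ltnW hn) hodd line_sum i a_inj.
Qed.
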